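(* Let $\mathscr T=(V,E)$ be a rooted and leafless directed tree. Let $S_{\boldsymbol\lambda}\in\boldsymbol B(\ell^2(V))$ be a centered weighted shift on $\mathscr T$ with nonzero weights $\boldsymbol\lambda=\{\lambda_v\}_{v\in V^\circ}$. Then $S_{\boldsymbol\lambda}$ is type I centered.
   Context: A directed tree $\mathscr T=(V,E)$ is a directed graph that is connected (as an undirected graph), has no directed circuits, and in which every vertex has at most one parent. $\mathsf{Chi}(u)=\{v\in V:(u,v)\in E\}$ is the set of children of $u$; $\mathsf{par}(u)$ is the parent of $u$ (the unique $v$ with $(v,u)\in E$), if it exists. A vertex without a parent is a root; it is unique if it exists and is denoted $\mathsf{root}$; the tree is rooted if it has a root, and then $V^\circ=V\setminus\{\mathsf{root}\}$. Leafless means $\mathsf{Chi}(u)\neq\varnothing$ for all $u\in V$. For weights $\boldsymbol\lambda=\{\lambda_v\}_{v\in V^\circ}\subseteq\mathbb C$ with $\sup_{v\in V}\sum_{u\in\mathsf{Chi}(v)}|\lambda_u|^2<\infty$, the weighted shift $S_{\boldsymbol\lambda}$ on $\mathscr T$ is the bounded operator on $\ell^2(V)$ given by $(S_{\boldsymbol\lambda}f)(v)=\lambda_vf(\mathsf{par}(v))$ for $v\in V^\circ$ and $(S_{\boldsymbol\lambda}f)(\mathsf{root})=0$. $\boldsymbol B(\mathcal H)$ denotes the bounded operators on $\mathcal H$; $\mathcal R(A)$ is the range of $A$. A bounded operator $T$ on a complex Hilbert space $\mathcal H$ is centered if all the operators $T^{n}T^{*n}$, $T^{*n}T^{n}$,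 $n\geqslant1$, commute with each other. Let $T=U|T|$ be the polar decomposition ($U$ a partial isometry with $\ker U=\ker T$). A centered $T$ is type I centered if $U$ is a pure isometry (an isometry without nonzero unitary part); equivalently, $\bigcap_{n=1}^\infty\overline{\mathcal R(T^n)}=\{0\}$ and $\bigcap_{n=1}^\infty\overline{\mathcal R(|T^n|)}=\mathcal H$. *)

(* Defs.v *)
From HB Require Import structures.
From mathcomp Require Import all_boot all_order all_algebra.
From mathcomp Require Import all_classical all_reals all_analysis.
From mathcomp Require Import finmap complex.
From mathcomp Require Import ring lra.
From Stdlib Require Import Relation_Operators.
Set Implicit Arguments.
Unset Strict Implicit.
Unset Printing Implicit Defensive.
Import Order.TTheory GRing.Theory Num.Theory.
Import numFieldNormedType.Exports.
Import Normc.
Local Open Scope classical_set_scope.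
Local Open Scope complex_scope.
Local Open Scope ring_scope.

(* Complex Hilbert spaces; the inner product is linear in its first argument
   and induces the norm, so positive definiteness comes from that of the norm. *)
HB.mixin Record CompleteNormedModule_isHilbert (R : realType) H
    of CompleteNormedModule R[i] H := {
  inner : H -> H -> R[i];
  innerDl : forall x y z : H, inner (x + y) z = inner x z + inner y z;
  innerZl : forall (a : R[i]) (x y : H), inner (a *: x) y = a * inner x y;
  innerC : forall x y : H, inner x y = (inner y x)^*;
  inner_norm : forall x : H, inner x x = `|x| ^+ 2
}.

#[short(type="hilbertType")]
HB.structure Definition Hilbert (R : realType) :=
  {H of CompleteNormedModule R[i] H & CompleteNormedModule_isHilbert R H}.

HB.mixin Record isBoundedOp (R : realType) (H : hilbertType R) (T : H -> H) := {
  op_bounded : exists M : R, forall x : H, `|T x| <= M%:C * `|x|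
}.

#[short(type="boundedOp")]
HB.structure Definition BoundedOp (R : realType) (H : hilbertType R) :=
  {T of @GRing.Linear R[i] H H *:%R T & isBoundedOp R H T}.

Section operators.
Context (R : realType) (H : hilbertType R).
Implicit Types (T U P : boundedOp H) (M : set H).

(* For bounded [T] the set below is a singleton, by the Riesz representation
   theorem, so the default value [0] of [xget] is never used. *)
Definition adjoint (T : H -> H) (y : H) : H :=
  xget 0 [set z | forall x, inner (T x) y = inner x z].

Definition centered_family T : set (H -> H) :=
  [set A | exists2 n, (1 <= n)%N &
     A = iter n T \o iter n (adjoint T) \/ A = iter n (adjoint T) \o iter n T].

Definition centered T : Prop :=
  forall A B, centered_family T A -> centered_family T B -> A \o B = B \o A.

Definition positive_op P : Prop := forall x, 0 <= inner (P x) x.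

(* [P] is the modulus |T|, the positive square root of T^* T. *)
Definition is_absop T P : Prop :=
  positive_op P /\ forall x, P (P x) = adjoint T (T x).

Definition isometry_op U : Prop := forall x, `|U x| = `|x|.

Definition partial_isometry U : Prop :=
  forall x, (forall z, U z = 0 -> inner x z = 0) -> `|U x| = `|x|.

Definition polar_decomposition T U P : Prop :=
  [/\ is_absop T P, partial_isometry U, forall x, T x = U (P x) &
     forall x, U x = 0 <-> T x = 0].

Definition closed_subspace M : Prop :=
  [/\ closed M, M 0 & forall (a : R[i]) x y, M x -> M y -> M (a *: x + y)].

Definition reducing U M : Prop :=
  [/\ closed_subspace M, U @` M `<=` M & adjoint U @` M `<=` M].

Definition unitary_on U M : Prop :=
  U @` M = M /\ forall x, M x -> `|U x| = `|x|.

(* An isometry has no nonzero unitary part when the zero subspace is the only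
   reducing subspace on which it is unitary. *)
Definition pure_isometry U : Prop :=
  isometry_op U /\
  forall M, reducing U M -> unitary_on U M -> M = [set 0].

Definition type_I_centered T : Prop :=
  centered T /\
  exists U P, polar_decomposition T U P /\ pure_isometry U.

End operators.

Section nonneg_sums.
Context (R : realType) (V : choiceType).
Implicit Types (a b : V -> R).

Lemma esumZl (D : set V) (c : R) a : 0 <= c -> (forall v, 0 <= a v) ->
  (\esum_(v in D) (c * a v)%:E = c%:E * \esum_(v in D) (a v)%:E)%E.
Proof.
move=> c0 a0; rewrite /esum.
rewrite (_ : [set _ | _ in _] =
  [set c%:E * x | x in [set (\sum_(v \in A) (a v)%:E)%E | A in fsets D]]%E).
  rewrite ereal_supZl//; apply/set0P.
  by exists (\sum_(v \in set0) (a v)%:E)%E; exists set0 => //; exact: fsets_set0.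
rewrite image_comp; apply: eq_imagel => A [finA _] /=.
by rewrite !fsbig_finite//= ge0_sume_distrr// => *; rewrite lee_fin.
Qed.

Definition nnsummable a : Prop := (\esum_(v in setT) (a v)%:E < +oo)%E.

Definition nnsum a : R := fine (\esum_(v in setT) (a v)%:E).

Lemma nnsummable_le a b : (forall v, a v <= b v) ->
  nnsummable b -> nnsummable a.
Proof. by move=> ab; apply: le_lt_trans; apply: le_esum => v _; rewrite lee_fin. Qed.

Lemma nnsumE a : (forall v, 0 <= a v) -> nnsummable a ->
  (\esum_(v in setT) (a v)%:E = (nnsum a)%:E)%E.
Proof.
move=> a0 sa; rewrite /nnsum fineK// ge0_fin_numE//.
by apply: esum_ge0 => v _; rewrite lee_fin.
Qed.

Lemma nnsum_ge0 a : (forall v, 0 <= a v) -> 0 <= nnsum a.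
Proof. by move=> a0; apply/fine_ge0/esum_ge0 => v _; rewrite lee_fin. Qed.

Lemma nnsum0 : nnsum (fun=> 0) = 0.
Proof. by rewrite /nnsum esum1. Qed.

Lemma nnsum_le a b : (forall v, 0 <= a v) -> (forall v, a v <= b v) ->
  nnsummable b -> nnsum a <= nnsum b.
Proof.
move=> a0 ab sb; have b0 v : 0 <= b v by rewrite (le_trans (a0 v)).
rewrite -lee_fin -!nnsumE//; last exact: nnsummable_le sb.
by apply: le_esum => v _; rewrite lee_fin.
Qed.

Lemma nnsum_ge a v : (forall v, 0 <= a v) -> nnsummable a -> a v <= nnsum a.
Proof.
move=> a0 sa; rewrite -lee_fin -nnsumE//; apply: esum_ge.
by exists [set v] => //; rewrite fsbig_set1.
Qed.

Lemma nnsummableD a b : (forall v, 0 <= a v) -> (forall v, 0 <= b v) ->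
  nnsummable a -> nnsummable b -> nnsummable (fun v => a v + b v).
Proof.
move=> a0 b0 sa sb; rewrite /nnsummable.
under eq_esum do rewrite EFinD.
by rewrite esumD ?nnsumE ?ltry// => v _; rewrite lee_fin.
Qed.

Lemma nnsumD a b : (forall v, 0 <= a v) -> (forall v, 0 <= b v) ->
  nnsummable a -> nnsummable b ->
  nnsum (fun v => a v + b v) = nnsum a + nnsum b.
Proof.
move=> a0 b0 sa sb; apply: EFin_inj; rewrite -nnsumE.
- under eq_esum do rewrite EFinD.
  by rewrite esumD ?nnsumE// => v _; rewrite lee_fin.
- by move=> v; rewrite addr_ge0.
- exact: nnsummableD.
Qed.

Lemma nnsummableZ c a : 0 <= c -> (forall v, 0 <= a v) ->
  nnsummable a -> nnsummable (fun v => c * a v).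
Proof. by move=> c0 a0 sa; rewrite /nnsummable esumZl// nnsumE// -EFinM ltry. Qed.

Lemma nnsumZ c a : 0 <= c -> (forall v, 0 <= a v) -> nnsummable a ->
  nnsum (fun v => c * a v) = c * nnsum a.
Proof. by move=> c0 a0 sa; rewrite /nnsum esumZl// [in LHS]nnsumE// -EFinM. Qed.

Lemma nnsum_fin_le a (M : R) : (forall v, 0 <= a v) ->
  (forall s : {fset V}, \sum_(v <- s) a v <= M) ->
  nnsummable a /\ nnsum a <= M.
Proof.
move=> a0 aM.
have le : (\esum_(v in setT) (a v)%:E <= M%:E)%E.
  apply: ge_ereal_sup => _ [A [finA _] <-].
  by rewrite fsbig_finite//= sumEFin lee_fin.
have sa : nnsummable a by rewrite /nnsummable (le_lt_trans le)// ltry.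
by split=> //; rewrite -lee_fin -nnsumE.
Qed.

Lemma nnsum_fset_le a (s : {fset V}) : (forall v, 0 <= a v) -> nnsummable a ->
  \sum_(v <- s) a v <= nnsum a.
Proof.
move=> a0 sa; rewrite -lee_fin -nnsumE// -sumEFin; apply: esum_ge.
exists [set` s]; first by split.
by rewrite fsbig_finite//= set_fsetK.
Qed.

End nonneg_sums.

Section real_sums.
Context (R : realType) (V : choiceType).
Implicit Types (g h : V -> R).

Definition rsum g : R :=
  nnsum (fun v => Num.max (g v) 0) - nnsum (fun v => Num.max (- g v) 0).

Definition rsummable g : Prop := nnsummable (fun v => `|g v|).

Let max0_ge0 (x : R) : 0 <= Num.max x 0. Proof. by rewrite le_max lexx orbT. Qed.

Let maxB (x : R) : Num.max x 0 - Num.max (- x) 0 = x.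
Proof. by rewrite /Num.max; do 2!case: ifP; lra. Qed.

Let max_le_norm (x : R) : Num.max x 0 <= `|x|.
Proof. by rewrite ge_max ler_norm normr_ge0. Qed.

Lemma rsummable_pos g : rsummable g -> nnsummable (fun v => Num.max (g v) 0).
Proof. by apply: nnsummable_le => v; exact: max_le_norm. Qed.

Lemma rsummable_neg g : rsummable g -> nnsummable (fun v => Num.max (- g v) 0).
Proof. by apply: nnsummable_le => v; rewrite -normrN; exact: max_le_norm. Qed.

Lemma rsumB (a b : V -> R) : (forall v, 0 <= a v) -> (forall v, 0 <= b v) ->
  nnsummable a -> nnsummable b -> rsum (fun v => a v - b v) = nnsum a - nnsum b.
Proof.
move=> a0 b0 sa sb; rewrite /rsum.
have sg : rsummable (fun v => a v - b v).
  apply: nnsummable_le (nnsummableD a0 b0 sa sb) => v.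
  by rewrite (le_trans (ler_normB _ _))// !ger0_norm.
apply/eqP; rewrite subr_eq addrAC eq_sym subr_eq; apply/eqP.
have := rsummable_pos sg; have := rsummable_neg sg => /= sn sp.
rewrite -!nnsumD//; congr nnsum; apply/funext => v.
by have := maxB (a v - b v); lra.
Qed.

Lemma rsum_nonneg (a : V -> R) : (forall v, 0 <= a v) -> rsum a = nnsum a.
Proof.
move=> a0; rewrite /rsum.
rewrite [X in _ - nnsum X](_ : _ = fun=> 0).
  by rewrite nnsum0 subr0; congr nnsum; apply/funext => v; rewrite max_l.
by apply/funext => v; rewrite max_r// oppr_le0.
Qed.

Lemma rsumD g h : rsummable g -> rsummable h ->
  rsum (fun v => g v + h v) = rsum g + rsum h.
Proof.
move=> sg sh.
have [gp gn hp hn] := And4 (rsummable_pos sg) (rsummable_neg sg)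
  (rsummable_pos sh) (rsummable_neg sh).
transitivity (rsum (fun v => (Num.max (g v) 0 + Num.max (h v) 0) -
    (Num.max (- g v) 0 + Num.max (- h v) 0))).
  congr rsum; apply/funext => v.
  by have := maxB (g v); have := maxB (h v); lra.
rewrite rsumB => [|v|v||]; rewrite ?addr_ge0//; try exact: nnsummableD.
by rewrite !nnsumD// /rsum; lra.
Qed.

Lemma rsumN g : rsum (fun v => - g v) = - rsum g.
Proof.
by rewrite /rsum opprB; congr (_ - nnsum _); apply/funext => v; rewrite opprK.
Qed.

Lemma rsumZ c g : rsummable g -> rsum (fun v => c * g v) = c * rsum g.
Proof.
move=> sg; wlog c0 : c / 0 <= c => [hw|].
  have [|/ltW c0] := leP 0 c; first exact: hw.
  rewrite -[RHS]opprK -mulNr -hw ?oppr_ge0// -rsumN.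
  by congr rsum; apply/funext => v; rewrite mulNr opprK.
have [gp gn] := (rsummable_pos sg, rsummable_neg sg).
transitivity (rsum (fun v => c * Num.max (g v) 0 - c * Num.max (- g v) 0)).
  by congr rsum; apply/funext => v; rewrite -mulrBr maxB.
rewrite rsumB => [|v|v||]; rewrite ?mulr_ge0//; try exact: nnsummableZ.
by rewrite !nnsumZ// -mulrBr.
Qed.

End real_sums.

Section normc_facts.
Context (R : realType).
Implicit Types x y : R[i].

Lemma normc_ge0 x : 0 <= normc x.
Proof. by case: x => a b; exact: sqrtr_ge0. Qed.

Lemma sqr_normc x : normc x ^+ 2 = complex.Re x ^+ 2 + complex.Im x ^+ 2.
Proof. by case: x => a b /=; rewrite sqr_sqrtr// addr_ge0 ?sqr_ge0. Qed.

Lemma normc_normr x : `|x| = (normc x)%:C.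
Proof. by case: x. Qed.

Lemma ler_normcD x y : normc (x + y) <= normc x + normc y.
Proof. by have := ler_normD x y; rewrite !normc_normr -rmorphD/= lecR. Qed.

Lemma normc_Re x : `|complex.Re x| <= normc x.
Proof.
by case: x => a b /=; rewrite -sqrtr_sqr ler_wsqrtr// lerDl sqr_ge0.
Qed.

Lemma normc_Im x : `|complex.Im x| <= normc x.
Proof.
by case: x => a b /=; rewrite -sqrtr_sqr ler_wsqrtr// lerDr sqr_ge0.
Qed.

Lemma sqr_normcD_le (a b : R) x y : 0 < a -> 0 < b ->
  normc (x + y) ^+ 2 <=
  (1 + b / a) * normc x ^+ 2 + (1 + a / b) * normc y ^+ 2.
Proof.
move=> a0 b0; set p := normc x; set q := normc y.
apply: (@le_trans _ _ ((p + q) ^+ 2)).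
  by rewrite ler_pXn2r ?nnegrE ?addr_ge0 ?normc_ge0// ler_normcD.
rewrite -subr_ge0.
have -> : (1 + b / a) * p ^+ 2 + (1 + a / b) * q ^+ 2 - (p + q) ^+ 2 =
    (b * p - a * q) ^+ 2 / (a * b) by field; rewrite !gt_eqF.
by rewrite divr_ge0 ?sqr_ge0// mulr_ge0 ?ltW.
Qed.

End normc_facts.

Section complex_sums.
Context (R : realType) (V : choiceType).
Implicit Types (f g : V -> R[i]).

Definition csummable f : Prop := nnsummable (fun v => normc (f v)).

(* The unconditional sum of an absolutely summable complex family. *)
Definition csum f : R[i] :=
  rsum (fun v => complex.Re (f v)) +i* rsum (fun v => complex.Im (f v)).

Lemma csummable_Re f : csummable f -> rsummable (fun v => complex.Re (f v)).
Proof. by apply: nnsummable_le => v; exact: normc_Re. Qed.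

Lemma csummable_Im f : csummable f -> rsummable (fun v => complex.Im (f v)).
Proof. by apply: nnsummable_le => v; exact: normc_Im. Qed.

Lemma csumD f g : csummable f -> csummable g ->
  csum (fun v => f v + g v) = csum f + csum g.
Proof.
move=> sf sg; rewrite /csum; simpc.
rewrite -(rsumD (csummable_Re sf) (csummable_Re sg)).
rewrite -(rsumD (csummable_Im sf) (csummable_Im sg)).
by congr Complex; congr rsum; apply/funext => v; case: (f v) (g v) => ? ? [].
Qed.

Lemma csumZ (c : R[i]) f : csummable f ->
  csum (fun v => c * f v) = c * csum f.
Proof.
move=> sf; have [sr si] := (csummable_Re sf, csummable_Im sf).
have sM (d : R) (g : V -> R) : rsummable g -> rsummable (fun v => d * g v).
  rewrite /rsummable => sg; under eq_fun do rewrite normrM.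
  exact: nnsummableZ.
case: c => a b; rewrite /csum; simpc; congr Complex.
  rewrite -(rsumZ a sr) -mulNr -(rsumZ (- b) si) -(rsumD (sM _ _ sr) (sM _ _ si)).
  by congr rsum; apply/funext => v; case: (f v) => p q /=; rewrite mulNr.
rewrite -(rsumZ a si) -(rsumZ b sr) -(rsumD (sM _ _ si) (sM _ _ sr)).
by congr rsum; apply/funext => v; case: (f v) => p q /=.
Qed.

Lemma csumJ f : csum (fun v => (f v)^*) = (csum f)^*.
Proof.
congr Complex; first by congr rsum; apply/funext => v; case: (f v).
by rewrite -[RHS]rsumN; congr rsum; apply/funext => v; case: (f v).
Qed.

End complex_sums.

Section l2_def.
Context (R : realType) (V : choiceType).

(* [normc z] is the modulus of [z : R[i]] as an element of [R]; [`|z|] has type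
   [R[i]]. *)
Definition l2_pred : {pred V -> R[i]} :=
  mem [set f : V -> R[i] | (\esum_(v in setT) (normc (f v) ^+ 2)%:E < +oo)%E].

Record l2 := L2 { l2_fun :> V -> R[i]; l2P : l2_fun \in l2_pred }.

HB.instance Definition _ := [isSub for l2_fun].
HB.instance Definition _ := [Choice of l2 by <:].

Let l2_predE (f : V -> R[i]) :
  (f \in l2_pred) = `[< nnsummable (fun v => normc (f v) ^+ 2) >].
Proof. by []. Qed.

Lemma l2_summable (f : l2) : nnsummable (fun v => normc (f v) ^+ 2).
Proof. by have := l2P f; rewrite l2_predE => /asboolP. Qed.

Lemma l2_submod_closed : submod_closed l2_pred.
Proof.
split=> [|c f g].
  rewrite l2_predE; apply/asboolP; rewrite /nnsummable esum1// => v _.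
  by rewrite normc0 expr0n.
rewrite !l2_predE => /asboolP sf /asboolP sg; apply/asboolP.
have s2 (h : V -> R[i]) := fun v => sqr_ge0 (normc (h v)).
have sh : @nnsummable R V (fun v => normc (c * f v) ^+ 2).
  under eq_fun do rewrite normcM exprMn.
  exact: nnsummableZ (sqr_ge0 _) (s2 f) sf.
have s02 : 0 <= 1 + 1 / 1 :> R by lra.
have cf := nnsummableZ s02 (s2 _) sh; have cg := nnsummableZ s02 (s2 _) sg.
apply: nnsummable_le (nnsummableD _ _ cf cg) => v; last 2 first.
- by rewrite mulr_ge0 ?sqr_ge0.
- by rewrite mulr_ge0 ?sqr_ge0.
- exact: sqr_normcD_le.
Qed.

HB.instance Definition _ :=
  GRing.isSubmodClosed.Build _ _ l2_pred l2_submod_closed.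
HB.instance Definition _ := [SubChoice_isSubLmodule of l2 by <:].

Lemma l2_ext (f g : l2) : (forall v, f v = g v) -> f = g.
Proof. by move=> fg; apply/val_inj/funext. Qed.

Lemma l2_addE (f g : l2) v : (f + g) v = f v + g v. Proof. by []. Qed.
Lemma l2_oppE (f : l2) v : (- f) v = - f v. Proof. by []. Qed.
Lemma l2_scaleE (c : R[i]) (f : l2) v : (c *: f) v = c * f v. Proof. by []. Qed.
Lemma l2_zeroE v : (0 : l2) v = 0. Proof. by []. Qed.

Definition l2sq (f : l2) : R := nnsum (fun v => normc (f v) ^+ 2).

Definition l2norm (f : l2) : R := Num.sqrt (l2sq f).

Lemma l2sq_ge0 f : 0 <= l2sq f.
Proof. by apply: nnsum_ge0 => v; exact: sqr_ge0. Qed.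

Lemma sqr_l2norm f : l2norm f ^+ 2 = l2sq f.
Proof. by rewrite sqr_sqrtr// l2sq_ge0. Qed.

Lemma l2norm_ge0 f : 0 <= l2norm f. Proof. exact: sqrtr_ge0. Qed.

Lemma normc_le_l2norm (f : l2) v : normc (f v) <= l2norm f.
Proof.
rewrite -(@ler_pXn2r _ 2) ?nnegrE ?normc_ge0 ?l2norm_ge0// sqr_l2norm.
exact: (nnsum_ge v (fun v => sqr_ge0 (normc (f v))) (l2_summable f)).
Qed.

Lemma l2norm_eq0 f : l2norm f = 0 -> f = 0.
Proof.
move=> f0; apply: l2_ext => v; apply: eq0_normc; apply/eqP.
by rewrite eq_le normc_ge0 andbT -f0 normc_le_l2norm.
Qed.

Lemma l2normZ (c : R[i]) f : l2norm (c *: f) = normc c * l2norm f.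
Proof.
have -> : l2norm (c *: f) = Num.sqrt (normc c ^+ 2 * l2sq f).
  congr Num.sqrt; rewrite -nnsumZ ?sqr_ge0//; last exact: l2_summable.
    by congr nnsum; apply/funext => v; rewrite l2_scaleE normcM exprMn.
  by move=> v; exact: sqr_ge0.
by rewrite sqrtrM ?sqr_ge0// sqrtr_sqr ger0_norm ?normc_ge0.
Qed.

Lemma ler_l2normD f g : l2norm (f + g) <= l2norm f + l2norm g.
Proof.
have [/eqP/l2norm_eq0 ->|f0] := boolP (l2norm f == 0).
  by rewrite add0r lerDr l2norm_ge0.
have [/eqP/l2norm_eq0 ->|g0] := boolP (l2norm g == 0).
  by rewrite addr0 lerDl l2norm_ge0.
have {}f0 : 0 < l2norm f by rewrite lt_def f0 l2norm_ge0.
have {}g0 : 0 < l2norm g by rewrite lt_def g0 l2norm_ge0.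
set a := l2norm f in f0 *; set b := l2norm g in g0 *.
rewrite -(@ler_pXn2r _ 2) ?nnegrE ?addr_ge0 ?l2norm_ge0// sqr_l2norm.
have cf : 0 <= 1 + b / a by rewrite addr_ge0// divr_ge0// ltW.
have cg : 0 <= 1 + a / b by rewrite addr_ge0// divr_ge0// ltW.
have pf v : 0 <= (1 + b / a) * normc (f v) ^+ 2 by rewrite mulr_ge0 ?sqr_ge0.
have pg v : 0 <= (1 + a / b) * normc (g v) ^+ 2 by rewrite mulr_ge0 ?sqr_ge0.
have s2 (h : l2) := fun v => sqr_ge0 (normc (h v)).
have sf := nnsummableZ cf (s2 f) (l2_summable f).
have sg := nnsummableZ cg (s2 g) (l2_summable g).
apply: (@le_trans _ _ (nnsum (fun v =>
    (1 + b / a) * normc (f v) ^+ 2 + (1 + a / b) * normc (g v) ^+ 2))).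
  apply: nnsum_le => [v|v|]; first exact: sqr_ge0.
    exact: sqr_normcD_le.
  exact: nnsummableD.
rewrite nnsumD// !nnsumZ//; try exact: l2_summable.
rewrite -![nnsum _]sqr_l2norm -/a -/b le_eqVlt; apply/orP; left; apply/eqP.
by field; rewrite !gt_eqF.
Qed.

Let norm_triangle f g :
  (l2norm (f + g))%:C <= (l2norm f)%:C + (l2norm g)%:C :> R[i].
Proof. by rewrite -rmorphD/= lecR ler_l2normD. Qed.

Let norm_scale (c : R[i]) f : (l2norm (c *: f))%:C = `|c| * (l2norm f)%:C.
Proof. by rewrite l2normZ rmorphM normc_normr. Qed.

Let norm_eq0 f : (l2norm f)%:C = 0 :> R[i] -> f = 0.
Proof. by case=> /l2norm_eq0. Qed.

HB.instance Definition _ := @Lmodule_isNormed.Build R[i] l2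
  (fun f => (l2norm f)%:C) norm_triangle norm_scale norm_eq0.

Lemma l2_normE (f : l2) : `|f| = (l2norm f)%:C. Proof. by []. Qed.

Lemma l2_ballE (f : l2) (e : R) : ball f e%:C = [set g | l2norm (f - g) < e].
Proof. by rewrite -ball_normE /ball_ /=; apply/seteqP; split=> g /=; rewrite l2_normE ltcR. Qed.

Section completeness.
Context (F : set_system l2) (FF : ProperFilter F) (cF : cauchy F).

Let F_ball (e : R) : 0 < e -> exists x : l2, F [set g | l2norm (x - g) < e].
Proof.
move=> e0; have /cauchyP /(_ e%:C) [|x] := cF; first by rewrite ltcR.
by rewrite l2_ballE; exists x.
Qed.

Let coord_cvg (p : R[i] -> R) v : (forall x y, `|p x - p y| <= normc (x - y)) ->
  cvg ((fun f : l2 => p (f v)) @ F).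
Proof.
move=> pP; apply: R_complete; apply: cauchy_exP => e e0.
have [x Fx] := F_ball e0; exists (p (x v)).
rewrite /nbhs/=; apply: filterS Fx => g /= xg.
rewrite -ball_normE /=; apply: le_lt_trans (pP _ _) (le_lt_trans _ xg).
exact: (normc_le_l2norm (x - g) v).
Qed.

Let re v : R := lim ((fun f : l2 => complex.Re (f v)) @ F).
Let im v : R := lim ((fun f : l2 => complex.Im (f v)) @ F).

Let re_cvg v : (fun f : l2 => complex.Re (f v)) @ F --> re v.
Proof.
apply: (coord_cvg (p := @complex.Re R)) => x y.
by rewrite (le_trans _ (normc_Re _))// (raddfB (@complex.Re R : Rcomplex R -> R)).
Qed.

Let im_cvg v : (fun f : l2 => complex.Im (f v)) @ F --> im v.
Proof.
apply: (coord_cvg (p := @complex.Im R)) => x y.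
by rewrite (le_trans _ (normc_Im _))// (raddfB (@complex.Im R : Rcomplex R -> R)).
Qed.

Let h v : R[i] := re v +i* im v.

Let h_close (x : l2) (e : R) : 0 < e -> F [set g | l2norm (x - g) < e] ->
  exists2 y : l2, (forall v, y v = x v - h v) & l2norm y <= e.
Proof.
move=> e0 Fx.
have [|s|sum_le] := @nnsum_fin_le R V (fun v => normc (x v - h v) ^+ 2) (e ^+ 2).
- by move=> v; exact: sqr_ge0.
- pose k (f : l2) : R := \sum_(v <- s) ((complex.Re (x v) - complex.Re (f v)) ^+ 2
    + (complex.Im (x v) - complex.Im (f v)) ^+ 2).
  have kcvg : k @ F --> \sum_(v <- s) normc (x v - h v) ^+ 2.
    apply: cvg_big => [|v _]; first exact: add_continuous.
    rewrite sqr_normc; case: (x v) => a b /=.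
    by apply: cvgD; rewrite expr2; under eq_fun do rewrite expr2; apply: cvgM;
      apply: cvgB => //; exact: cvg_cst.
  apply: (cvgr_to_le kcvg).
  apply: filterS Fx => g /= xg; apply: (@le_trans _ _ (l2sq (x - g))).
    apply: le_trans (nnsum_fset_le s _ (l2_summable (x - g))).
      rewrite le_eqVlt; apply/orP; left; apply/eqP; apply: eq_bigr => v _.
      by rewrite sqr_normc l2_addE l2_oppE; case: (x v) (g v) => ? ? [].
    by move=> v; exact: sqr_ge0.
  by rewrite -sqr_l2norm ler_pXn2r ?nnegrE ?l2norm_ge0// ltW.
move=> le_e; exists (@L2 (fun v => x v - h v) (asboolT sum_le)) => //.
by rewrite -(@ler_pXn2r _ 2) ?nnegrE ?l2norm_ge0 ?(ltW e0)// sqr_l2norm.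
Qed.

Lemma l2_cauchy_cvg : cvg F.
Proof.
have [x0 /(h_close ltr01) [y0 y0E _]] := F_ball ltr01.
have [g gE] : exists g : l2, forall v, g v = h v.
  by exists (x0 - y0) => v; rewrite l2_addE l2_oppE y0E opprB addrC subrK.
apply/cvg_ex; exists g; apply/cvg_ballP => e e0.
have [d eE] : exists d : R, e = d%:C.
  by case: e e0 => a b /= /andP[/eqP -> _]; exists a.
rewrite eE ltcR in e0; rewrite eE.
have d0 : 0 < d / 2 by rewrite divr_gt0.
have [x Fx] := F_ball d0; have [y yE ley] := h_close d0 Fx.
apply: filterS (Fx) => f /= xf; rewrite l2_ballE/=.
have -> : g - f = (x - f) - y.
  by apply: l2_ext => v; rewrite !(l2_addE, l2_oppE) yE gE; ring.
rewrite (splitr d) (le_lt_trans (ler_l2normD _ _))// ltr_leD//.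
by rewrite -scaleN1r l2normZ (_ : normc (-1) = 1) ?mul1r//= sqrrN expr1n oppr0 expr0n addr0 sqrtr1.
Qed.

End completeness.

HB.instance Definition _ := Uniform_isComplete.Build l2 l2_cauchy_cvg.

Let prod_summable (f g : l2) : csummable (fun v => f v * (g v)^*).
Proof.
have s2 (h : l2) v : 0 <= normc (h v) ^+ 2 := sqr_ge0 _.
apply: nnsummable_le (nnsummableD (s2 f) (s2 g) (l2_summable f) (l2_summable g)).
move=> v; rewrite normcM (_ : normc (g v)^* = normc (g v)); last first.
  by case: (g v) => a b /=; rewrite sqrrN.
have := sqr_ge0 (normc (f v) - normc (g v)).
have := mulr_ge0 (normc_ge0 (f v)) (normc_ge0 (g v)).
by rewrite sqrrB -mulr_natl; lra.
Qed.

Definition l2_inner (f g : l2) : R[i] := csum (fun v => f v * (g v)^*).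

Let l2_innerDl f g k : l2_inner (f + g) k = l2_inner f k + l2_inner g k.
Proof.
rewrite /l2_inner -(csumD (prod_summable f k) (prod_summable g k)).
by congr csum; apply/funext => v; rewrite l2_addE mulrDl.
Qed.

Let l2_innerZl (c : R[i]) f g : l2_inner (c *: f) g = c * l2_inner f g.
Proof.
rewrite /l2_inner -(csumZ _ (prod_summable f g)).
by congr csum; apply/funext => v; rewrite l2_scaleE mulrA.
Qed.

Let l2_innerC f g : l2_inner f g = (l2_inner g f)^*.
Proof.
rewrite /l2_inner -csumJ; congr csum; apply/funext => v.
by case: (f v) (g v) => a b [c d]; simpc; congr Complex; ring.
Qed.

Let l2_inner_norm f : l2_inner f f = `|f| ^+ 2.
Proof.
rewrite l2_normE -rmorphXn/= sqr_l2norm.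
have fE v : f v * (f v)^* = (normc (f v) ^+ 2)%:C.
  by rewrite sqr_normc; case: (f v) => a b; simpc; congr Complex; ring.
rewrite /l2_inner /csum; congr Complex.
  rewrite (_ : (fun v => _) = (fun v => normc (f v) ^+ 2)).
    by rewrite rsum_nonneg// => v; exact: sqr_ge0.
  by apply/funext => v; rewrite fE.
rewrite (_ : (fun v => _) = (fun=> 0)).
  by rewrite rsum_nonneg// nnsum0.
by apply/funext => v; rewrite fE.
Qed.

HB.instance Definition _ := CompleteNormedModule_isHilbert.Build R l2
  l2_innerDl l2_innerZl l2_innerC l2_inner_norm.

End l2_def.

Section directed_trees.
Context (V : choiceType) (E : V -> V -> Prop).

(* [clos_trans V E v v] says that [v] lies on a directed closed walk, so
   [tree_acyclic] also excludes loops. *)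
Record directed_tree : Prop := DirectedTree {
  tree_connected : forall u v, clos_refl_sym_trans V E u v;
  tree_acyclic : forall v, ~ clos_trans V E v v;
  tree_parent_unique : forall u u' v, E u v -> E u' v -> u = u'
}.

Definition children (u : V) : set V := [set v | E u v].

Definition parent (v : V) : option V := xget None [set Some u | u in E^~ v].

Definition is_root (v : V) : Prop := forall u, ~ E u v.

Definition rooted : Prop := exists v, is_root v.

Definition leafless : Prop := forall u, children u !=set0.

Lemma parentP u v : directed_tree -> E u v -> parent v = Some u.
Proof.
move=> tE Euv; rewrite /parent; case: xgetP => [x -> [u' Eu'v <-]|].
  by rewrite (tree_parent_unique tE Euv Eu'v).
by move=> /(_ (Some u)) []; exists u.
Qed.

Lemma parent_root v : is_root v -> parent v = None.
Proof. by move=> rv; rewrite /parent; case: xgetP => // x _ [u /rv]. Qed.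

End directed_trees.

Section weighted_shifts.
Context (R : realType) (V : choiceType) (E : V -> V -> Prop) (lambda : V -> R[i]).

(* The value of [lambda] at the root, which is not a weight, is never used. *)
Definition bounded_weights : Prop :=
  (ereal_sup [set \esum_(u in children E v) (normc (lambda u) ^+ 2)%:E
             | v in setT] < +oo)%E.

Definition shift_fun (f : V -> R[i]) (v : V) : R[i] :=
  if parent E v is Some u then lambda v * f u else 0.

Context (tE : directed_tree E) (bE : bounded_weights).

Lemma shift_bound : exists M : R, 0 <= M /\ forall f : l2 R V,
  (\esum_(v in setT) (normc (shift_fun f v) ^+ 2)%:E <= (M * l2sq f)%:E)%E.
Proof.
have [M [M0 leM]] : exists M : R, 0 <= M /\ forall u,
    (\esum_(v in children E u) (normc (lambda v) ^+ 2)%:E <= M%:E)%E.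
  have le u : (\esum_(v in children E u) (normc (lambda v) ^+ 2)%:E <=
      ereal_sup [set \esum_(u in children E v) (normc (lambda u) ^+ 2)%:E
             | v in setT])%E by apply: ereal_sup_ubound; exists u.
  move: bE le; rewrite /bounded_weights; case: ereal_sup => [r _ le|//|_ le].
    exists (Num.max r 0); split; first by rewrite le_max lexx orbT.
    by move=> u; rewrite (le_trans (le u))// lee_fin le_max lexx.
  by exists 0; split=> // u; rewrite (le_trans (le u))// leNye.
exists M; split=> // f.
have g0 v : (0 <= (normc (shift_fun f v) ^+ 2)%:E)%E by rewrite lee_fin sqr_ge0.
have -> : (\esum_(v in setT) (normc (shift_fun f v) ^+ 2)%:E =
    \esum_(v in \bigcup_(u in setT) children E u)
      (normc (shift_fun f v) ^+ 2)%:E)%E.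
  rewrite [RHS]esum_mkcond; apply: eq_esum => v _; case: ifPn => // /negP nv.
  rewrite /shift_fun parent_root ?normc0 ?expr0n// => u Euv; apply: nv.
  by apply: mem_set; exists u.
have bij : set_bij ([set: V] `*`` children E)
    (\bigcup_(u in [set: V]) children E u) snd.
  split=> [[u v] [_ Euv]|[u v] [u' v'] /set_mem[_ /= Euv] /set_mem[_ /= Eu'v'] vv'|].
  - by exists u.
  - by rewrite /= -vv' in Eu'v' *; rewrite (tree_parent_unique tE Euv Eu'v').
  - by move=> v [u _ Euv]; exists (u, v).
rewrite (reindex_esum _ _ _ _ bij) -(@esum_esum R V V setT (children E)
  (fun=> fun v => (normc (shift_fun f v) ^+ 2)%:E))//.
have s2 v : 0 <= normc (f v) ^+ 2 := sqr_ge0 _.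
rewrite EFinM -(nnsumE s2 (l2_summable f)) -esumZl//.
apply: le_esum => u _.
have -> : (\esum_(v in children E u) (normc (shift_fun f v) ^+ 2)%:E =
  \esum_(v in children E u) (normc (f u) ^+ 2 * normc (lambda v) ^+ 2)%:E)%E.
  apply: eq_esum => v Euv; rewrite /shift_fun (parentP tE Euv).
  by rewrite normcM exprMn mulrC.
rewrite esumZl ?sqr_ge0// => [|v]; last exact: sqr_ge0.
by rewrite [M * _]mulrC [X in (_ <= X)%E]EFinM lee_wpmul2l ?lee_fin ?sqr_ge0.
Qed.

Lemma shift_fun_is_l2 (f : l2 R V) : shift_fun f \in @l2_pred R V.
Proof.
apply/asboolP; have [M [_ /(_ f)]] := shift_bound.
by move=> /le_lt_trans; apply; rewrite ltry.
Qed.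

Definition weighted_shift_fun (f : l2 R V) : l2 R V := L2 (shift_fun_is_l2 f).

Lemma weighted_shift_linear : linear weighted_shift_fun.
Proof.
have sE h v : weighted_shift_fun h v = shift_fun h v by [].
move=> c f g; apply: l2_ext => v; rewrite l2_addE l2_scaleE !sE /shift_fun.
case: parent => [u|]; last by rewrite mulr0 addr0.
by rewrite l2_addE l2_scaleE; ring.
Qed.

Lemma weighted_shift_bounded : exists M : R, forall f, `|weighted_shift_fun f| <= M%:C * `|f|.
Proof.
have [M [M0 leM]] := shift_bound; exists (Num.sqrt M) => f.
rewrite !l2_normE -rmorphM/= lecR /l2norm -sqrtrM// ler_wsqrtr//.
rewrite -lee_fin -nnsumE; first exact: leM.
- by move=> v; exact: sqr_ge0.
- exact: l2_summable.
Qed.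

HB.instance Definition _ :=
  GRing.isLinear.Build R[i] (l2 R V) (l2 R V) *:%R weighted_shift_fun weighted_shift_linear.
HB.instance Definition _ :=
  isBoundedOp.Build R (l2 R V) weighted_shift_fun weighted_shift_bounded.

Definition weighted_shift : boundedOp (l2 R V) := weighted_shift_fun.

Lemma weighted_shiftE (f : l2 R V) v : weighted_shift f v = shift_fun f v.
Proof. by []. Qed.

End weighted_shifts.

(* Main.v *)
Require Import Defs.
From HB Require Import structures.
From mathcomp Require Import all_boot all_order all_algebra.
From mathcomp Require Import all_classical all_reals all_analysis.
From mathcomp Require Import complex.
From mathcomp Require Import ring.
From Stdlib Require Import Relation_Operators.
Set Implicit Arguments.
Unset Strict Implicit.
Unset Printing Implicit Defensive.
Import Order.TTheory GRing.Theory Num.Theory.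
Import Normc.
Local Open Scope classical_set_scope.
Local Open Scope complex_scope.
Local Open Scope ring_scope.

(** The polar decomposition of the shift [S] is explicit.  Each basis vector
    [e_u] is sent to the combination of the [e_v], [v] a child of [u], with
    coefficients [lambda v]; the images of distinct basis vectors have disjoint
    supports, hence are orthogonal.  So [S^* S] is diagonal, and [|S|] is the
    multiplication [P] by the function [a u = || S e_u ||], which is bounded,
    and positive because [u] has a child and weights do not vanish.  Dividing
    each weight by the value of [a] at the parent gives weights whose squared
    moduli sum to 1 over the children of any vertex; the shift [U] with these
    weights is an isometry, and [S = U P] ([weighted_shift_polar]).

    It remains to see that the isometry [U] is pure.  If [U] maps a subspace [M]
    onto itself, then every [f] in [M] is in the range of all powers of [U], so
    it vanishes at the root, at the children of the root, and so on: [M] is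
    zero ([weighted_shift_no_unitary_part]). *)

(** * Adjoints and isometries in a Hilbert space *)

Section hilbert.
Context (R : realType) (H : hilbertType R).
Implicit Types (x y z : H).

Lemma innerDr x y z : inner x (y + z) = inner x y + inner x z.
Proof. by rewrite innerC innerDl rmorphD/= -!innerC. Qed.

Lemma innerZr (a : R[i]) x y : inner x (a *: y) = a^* * inner x y.
Proof. by rewrite innerC innerZl rmorphM/= -innerC. Qed.

Lemma inner_self_eq0 x : inner x x = 0 -> x = 0.
Proof. by move=> /eqP; rewrite inner_norm expf_eq0/= normr_eq0 => /eqP. Qed.

Lemma adjoint_unique (T : H -> H) y z :
  (forall x, inner (T x) y = inner x z) -> adjoint T y = z.
Proof.
move=> Tyz; rewrite /adjoint; case: xgetP => [w _ Tyw|/(_ z) []//].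
apply/eqP; rewrite -subr_eq0; apply/eqP/inner_self_eq0.
by rewrite -[- z]scaleN1r innerDr innerZr -Tyw -Tyz rmorphN1 mulN1r subrr.
Qed.

(** Polarization: the defect [D] is a sesquilinear form that vanishes on the
    diagonal, and over the complex numbers such a form is zero. *)
Lemma isometry_inner (U : boundedOp H) x y :
  isometry_op U -> inner (U x) (U y) = inner x y.
Proof.
move=> Uiso; pose D a b : R[i] := inner (U a) (U b) - inner a b.
have D0 a : D a a = 0 by rewrite /D !inner_norm Uiso subrr.
have DE c : D x (c *: y) = c^* * D x y by rewrite /D linearZ/= !innerZr mulrBr.
have DE' c : D (c *: y) x = c * D y x by rewrite /D linearZ/= !innerZl mulrBr.
have Dsym c : c^* * D x y + c * D y x = 0.
  have := D0 (x + c *: y); rewrite -DE -DE' => <-.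
  rewrite -[LHS](addr0 _) -(addr0 0) -{1}(D0 x) -(D0 (c *: y)).
  by rewrite /D !linearD/= !innerDl !innerDr; ring.
(* [c = 1] makes [D] antisymmetric on [x, y], [c = i] makes it symmetric. *)
have /= D1 := Dsym 1; have /= Di := Dsym 'i%C.
rewrite rmorph1 !mul1r in D1.
suff : D x y = 0 by move/eqP; rewrite subr_eq0 => /eqP.
have DN : D y x = - D x y by apply/eqP; rewrite -addr_eq0 addrC D1.
have : - (2 * 'i%C) * D x y = 0.
  by rewrite -Di DN (_ : ('i%C)^* = - 'i%C :> R[i]); [ring|simpc].
move=> /eqP; rewrite mulf_eq0 oppr_eq0 mulf_eq0 pnatr_eq0/= => /orP[|/eqP//].
by rewrite eq_complex /= oner_eq0 andbF.
Qed.

Lemma isometry_eq0 (U : boundedOp H) x : isometry_op U -> U x = 0 -> x = 0.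
Proof. by move=> Uiso Ux0; apply/normr0_eq0; rewrite -Uiso Ux0 normr0. Qed.

End hilbert.

(** * Multiplication by a bounded nonnegative function *)

Section multiplication_operator.
Context (R : realType) (V : choiceType).
Variables (a : V -> R) (M : R).
Hypotheses (a_ge0 : forall v, 0 <= a v) (aM : forall v, a v <= M).

Let mulop_bound (f : l2 R V) v :
  normc ((a v)%:C * f v) ^+ 2 <= M ^+ 2 * normc (f v) ^+ 2.
Proof.
rewrite normcM exprMn ler_wpM2r ?sqr_ge0//= expr0n addr0 sqr_sqrtr ?sqr_ge0//.
by rewrite ler_pXn2r ?nnegrE ?(le_trans (a_ge0 v)).
Qed.

Let mulop_dominated (f : l2 R V) :
  nnsummable (fun v => M ^+ 2 * normc (f v) ^+ 2).
Proof.
by apply: nnsummableZ (sqr_ge0 _) _ (l2_summable f) => v; exact: sqr_ge0.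
Qed.

Lemma mulop_is_l2 (f : l2 R V) : (fun v => (a v)%:C * f v) \in @l2_pred R V.
Proof.
apply/asboolP; apply: nnsummable_le (mulop_dominated f) => v.
exact: mulop_bound.
Qed.

Definition mulop_fun (f : l2 R V) : l2 R V := L2 (mulop_is_l2 f).

Lemma mulop_linear : linear mulop_fun.
Proof.
have mE h v : mulop_fun h v = (a v)%:C * h v by [].
move=> c f g; apply: l2_ext => v.
by rewrite l2_addE l2_scaleE !mE l2_addE l2_scaleE; ring.
Qed.

Lemma mulop_bounded : exists C : R, forall f, `|mulop_fun f| <= C%:C * `|f|.
Proof.
exists (Num.sqrt (M ^+ 2)) => f.
rewrite !l2_normE -rmorphM/= lecR /l2norm -sqrtrM ?sqr_ge0// ler_wsqrtr//.
rewrite /l2sq -nnsumZ ?sqr_ge0//; last exact: l2_summable.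
  apply: nnsum_le (mulop_dominated f) => v; first exact: sqr_ge0.
  exact: mulop_bound.
by move=> v; exact: sqr_ge0.
Qed.

HB.instance Definition _ :=
  GRing.isLinear.Build R[i] (l2 R V) (l2 R V) *:%R mulop_fun mulop_linear.
HB.instance Definition _ :=
  isBoundedOp.Build R (l2 R V) mulop_fun mulop_bounded.

Definition mulop : boundedOp (l2 R V) := mulop_fun.

Lemma mulopE f v : mulop f v = (a v)%:C * f v.
Proof. by []. Qed.

Lemma mulop_selfadjoint f g : inner (mulop f) g = inner f (mulop g).
Proof.
congr csum; apply/funext => v; rewrite !mulopE.
by case: (f v) (g v) => p q [r s]; simpc; congr Complex; ring.
Qed.

Lemma mulop_positive : positive_op mulop.
Proof.
move=> f; rewrite /inner/= /l2_inner /csum.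
have fE v : mulop f v * (f v)^* = (a v * normc (f v) ^+ 2)%:C.
  rewrite mulopE Defs.sqr_normc; case: (f v) => p q; simpc.
  by congr Complex; rewrite /=; ring.
rewrite lecE /= -(_ : (fun=> 0) = (fun v => complex.Im (mulop f v * (f v)^*)));
  last by apply/funext => v; rewrite fE.
rewrite (rsum_nonneg (a := fun=> 0))// nnsum0 eqxx/=.
have p0 v : 0 <= complex.Re (mulop f v * (f v)^*).
  by rewrite fE/= mulr_ge0 ?sqr_ge0.
by rewrite rsum_nonneg ?nnsum_ge0.
Qed.

End multiplication_operator.

(** * Weighted shifts: norm and purity *)

Section shift.
Context (R : realType) (V : choiceType) (E : V -> V -> Prop).
Hypothesis tE : directed_tree E.
Implicit Types (w : V -> R[i]).

Lemma parent_edge v u : parent E v = Some u -> E u v.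
Proof. by rewrite /parent; case: xgetP => [_ -> [u' Euv <-] [<-]|]. Qed.

(** Every vertex other than the root is a child of exactly one vertex, so the
    sum over vertices regroups by parents; the root contributes zero. *)
Lemma esum_shift w (f : l2 R V) :
  (\esum_(v in setT) (normc (shift_fun E w f v) ^+ 2)%:E =
   \esum_(u in setT) ((normc (f u) ^+ 2)%:E *
      \esum_(v in children E u) (normc (w v) ^+ 2)%:E))%E.
Proof.
have -> : (\esum_(v in setT) (normc (shift_fun E w f v) ^+ 2)%:E =
    \esum_(v in \bigcup_(u in setT) children E u)
      (normc (shift_fun E w f v) ^+ 2)%:E)%E.
  rewrite [RHS]esum_mkcond; apply: eq_esum => v _; case: ifPn => // /negP nv.
  rewrite /shift_fun parent_root ?normc0 ?expr0n// => u Euv; apply: nv.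
  by apply: mem_set; exists u.
have bij : set_bij ([set: V] `*`` children E)
    (\bigcup_(u in [set: V]) children E u) snd.
  split=> [[u v] [_ Euv]|[u v] [u' v'] /set_mem[_ /= Euv] /set_mem[_ /= Eu'v'] vv'|].
  - by exists u.
  - by rewrite /= -vv' in Eu'v' *; rewrite (tree_parent_unique tE Euv Eu'v').
  - by move=> v [u _ Euv]; exists (u, v).
have g0 v : (0 <= (normc (shift_fun E w f v) ^+ 2)%:E)%E.
  by rewrite lee_fin sqr_ge0.
rewrite (reindex_esum _ _ _ _ bij) -(@esum_esum R V V setT (children E)
  (fun=> fun v => (normc (shift_fun E w f v) ^+ 2)%:E))//.
apply: eq_esum => u _.
rewrite -esumZl ?sqr_ge0// => [|v]; last exact: sqr_ge0.
apply: eq_esum => v Euv; rewrite /shift_fun (parentP tE Euv).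
by rewrite normcM exprMn mulrC.
Qed.

Lemma weighted_shift_isometry w (bw : bounded_weights E w) :
  (forall u, \esum_(v in children E u) (normc (w v) ^+ 2)%:E = 1)%E ->
  isometry_op (weighted_shift tE bw).
Proof.
move=> w1 f; rewrite !l2_normE; congr (_ %:C); congr Num.sqrt; congr fine.
by rewrite esum_shift; apply: eq_esum => u _; rewrite w1 mule1.
Qed.

(** The vertices at which all of [M] vanishes include the root, as ranges of
    shifts vanish there.  They are stable under children, as an element of [M]
    is the image of one; they are also stable under parents, as [M] contains the
    images of its elements and weights are nonzero.  Stability in both
    directions lets connectedness of the tree conclude, with no induction on
    the distance to the root. *)
Lemma weighted_shift_no_unitary_part w (bw : bounded_weights E w)
    (M : set (l2 R V)) :
  rooted E -> (forall v, ~ is_root E v -> w v != 0) ->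
  weighted_shift tE bw @` M = M -> forall f, M f -> f = 0.
Proof.
set S := weighted_shift tE bw => -[r rr] w0 SM.
pose null v := forall f, M f -> f v = 0.
have null_edge u v : E u v -> null u <-> null v.
  move=> Euv; have SE f : S f v = w v * f u.
    by rewrite weighted_shiftE /shift_fun (parentP tE Euv).
  split=> [u0|v0] f Mf.
    by move: Mf; rewrite -SM => -[g /u0 gu0 <-]; rewrite SE gu0 mulr0.
  have : S f v = 0 by apply: v0; rewrite -SM; exists f.
  move=> /eqP; rewrite SE mulf_eq0 => /orP[/eqP wv0|/eqP//].
  by have := w0 v; rewrite wv0 eqxx => /(_ (fun rv => rv u Euv)).
have null_root : null r.
  move=> f; rewrite -SM => -[g _ <-].
  by rewrite weighted_shiftE /shift_fun parent_root.
have null_all v : null v.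
  suff H u u' : clos_refl_sym_trans V E u u' -> null u <-> null u'.
    by apply/(H r v) => //; exact: tree_connected tE r v.
  by elim=> {u u'} [u u' /null_edge|//|u u' _ ->|u u' u'' _ -> _ ->].
by move=> f Mf; apply: l2_ext => v; rewrite (null_all v).
Qed.

Lemma weighted_shift_pure w (bw : bounded_weights E w) :
  rooted E -> (forall v, ~ is_root E v -> w v != 0) ->
  isometry_op (weighted_shift tE bw) -> pure_isometry (weighted_shift tE bw).
Proof.
move=> rE w0 iso; split=> // M [[_ M0 _] _ _] [SM _].
apply/seteqP; split=> [f Mf|_ ->//].
exact: (weighted_shift_no_unitary_part rE w0 SM Mf).
Qed.

End shift.

(** * Polar decomposition of a weighted shift *)

Section modulus.
Context (R : realType) (V : choiceType) (E : V -> V -> Prop).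
Context (w : V -> R[i]) (bw : bounded_weights E w).
Hypothesis tE : directed_tree E.
Hypothesis lE : leafless E.
Hypothesis w_neq0 : forall v, ~ is_root E v -> w v != 0.

(** The norm of the image of the basis vector at [u] under the shift. *)
Definition child_norm (u : V) : R :=
  Num.sqrt (fine (\esum_(v in children E u) (normc (w v) ^+ 2)%:E)%E).

Let esum_child_ge0 u : (0 <= \esum_(v in children E u) (normc (w v) ^+ 2)%:E)%E.
Proof. by apply: esum_ge0 => v _; rewrite lee_fin sqr_ge0. Qed.

Lemma esum_child_le u :
  (\esum_(v in children E u) (normc (w v) ^+ 2)%:E <=
   ereal_sup [set \esum_(u in children E v) (normc (w u) ^+ 2)%:E
             | v in setT])%E.
Proof. by apply: ereal_sup_ubound; exists u. Qed.

Lemma sqr_child_norm u :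
  (\esum_(v in children E u) (normc (w v) ^+ 2)%:E = (child_norm u ^+ 2)%:E)%E.
Proof.
rewrite sqr_sqrtr ?fine_ge0// fineK// ge0_fin_numE//.
exact: le_lt_trans (esum_child_le u) bw.
Qed.

Lemma child_norm_ge0 u : 0 <= child_norm u.
Proof. exact: sqrtr_ge0. Qed.

Lemma child_norm_gt0 u : 0 < child_norm u.
Proof.
rewrite lt_def child_norm_ge0 andbT -sqrf_eq0.
rewrite -eqe -sqr_child_norm gt_eqF//.
have [v Euv] := lE u.
have wv : 0 < normc (w v).
  rewrite lt_def normc_ge0 andbT; apply/eqP => /eq0_normc wv0.
  by have := w_neq0 (fun rv => rv u Euv); rewrite wv0 eqxx.
apply: (@lt_le_trans _ _ (normc (w v) ^+ 2)%:E); first by rewrite lte_fin exprn_gt0.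
apply: esum_ge; exists [set v]; last by rewrite fsbig_set1.
by split=> // _ ->.
Qed.

Lemma child_norm_bounded : exists M, forall u, child_norm u <= M.
Proof.
have := esum_child_le; have := bw; rewrite /bounded_weights.
case: ereal_sup => [s _ le|//|_ le].
  exists (Num.sqrt s) => u; rewrite ler_wsqrtr// -lee_fin fineK ?le//.
  by rewrite sqr_child_norm.
by exists 0 => u; have := le u; rewrite sqr_child_norm leeNy_eq.
Qed.

(** The weights of the isometric factor; the value 0 at the root is a dummy,
    since a shift does not read it. *)
Definition normalized_weight v : R[i] :=
  if parent E v is Some u then w v / (child_norm u)%:C else 0.

Lemma normalized_weight_neq0 v : ~ is_root E v -> normalized_weight v != 0.
Proof.
move=> nr; have [u Euv] : exists u, E u v.
  by apply: contrapT => nu; apply: nr => u Euv; apply: nu; exists u.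
rewrite /normalized_weight (parentP tE Euv) mulf_neq0 ?w_neq0//.
by rewrite invr_eq0 fmorph_eq0 gt_eqF ?child_norm_gt0.
Qed.

Lemma esum_normalized_weight u :
  (\esum_(v in children E u) (normc (normalized_weight v) ^+ 2)%:E = 1)%E.
Proof.
have a0 := child_norm_gt0 u.
transitivity (\esum_(v in children E u)
    ((child_norm u ^+ 2)^-1 * normc (w v) ^+ 2)%:E)%E.
  apply: eq_esum => v Euv; rewrite /normalized_weight (parentP tE Euv).
  rewrite normcM exprMn mulrC -fmorphV/= expr0n addr0 sqrtr_sqr ger0_norm.
    by rewrite exprVn.
  by rewrite invr_ge0 ltW.
rewrite esumZl ?invr_ge0 ?sqr_ge0// => [|v]; last exact: sqr_ge0.
by rewrite sqr_child_norm -EFinM mulVf// expf_neq0 ?gt_eqF.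
Qed.

Lemma normalized_weight_bounded : bounded_weights E normalized_weight.
Proof.
apply: (@le_lt_trans _ _ 1%E); last exact: ltry.
by apply: ge_ereal_sup => _ [u _ <-]; rewrite esum_normalized_weight.
Qed.

(** That [P P = S^* S] needs no computation of the adjoint of [S]: since [U]
    preserves inner products and [P] is self-adjoint,
    [<S g, S f> = <P g, P f> = <g, P P f>].  The kernels of [U] and [S] are both
    zero, as [U] is isometric and [P] multiplies by a positive function. *)
Lemma weighted_shift_polar M (aM : forall u, child_norm u <= M) :
  polar_decomposition (weighted_shift tE bw)
    (weighted_shift tE normalized_weight_bounded) (mulop child_norm_ge0 aM).
Proof.
set U := weighted_shift _ normalized_weight_bounded; set P := mulop _ _.
set S := weighted_shift _ _.
have Uiso : isometry_op U by exact/weighted_shift_isometry/esum_normalized_weight.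
have a0 u : (child_norm u)%:C != 0 :> R[i].
  by rewrite fmorph_eq0 gt_eqF ?child_norm_gt0.
have SE f : S f = U (P f).
  apply: l2_ext => v; rewrite !weighted_shiftE /shift_fun /normalized_weight.
  by case: parent => // u; rewrite mulopE mulrA divfK.
split=> [|f _|//|f]; [|exact: Uiso f|].
  split=> [|f]; first exact: mulop_positive.
  apply/esym/adjoint_unique => g.
  by rewrite !SE isometry_inner// mulop_selfadjoint.
split=> [/(isometry_eq0 Uiso) ->|]; first by rewrite linear0.
rewrite SE => /(isometry_eq0 Uiso) Pf0.
suff -> : f = 0 by rewrite linear0.
apply: l2_ext => v; have /eqP := congr1 (fun g : l2 R V => g v) Pf0.
by rewrite mulopE mulf_eq0 (negPf (a0 v))/= => /eqP.
Qed.

End modulus.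

Theorem proposition24 (R : realType) (V : choiceType) (E : V -> V -> Prop)
    (tE : directed_tree E) (rE : rooted E) (lE : leafless E)
    (lambda : V -> R[i]) (blambda : bounded_weights E lambda)
    (lambda_neq0 : forall v, ~ is_root E v -> lambda v != 0)
    (cS : centered (weighted_shift tE blambda)) :
  type_I_centered (weighted_shift tE blambda).
Proof.
split=> //; have [M aM] := child_norm_bounded blambda.
exists (weighted_shift tE (normalized_weight_bounded blambda tE lE lambda_neq0)).
exists (mulop (child_norm_ge0 E lambda) aM); split.
  exact: weighted_shift_polar.
apply: weighted_shift_pure => //; first exact: normalized_weight_neq0.
apply: weighted_shift_isometry; exact: esum_normalized_weight.
Qed.
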